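(* A $0.89$-DMMS matching may not exist, even when agents on both sides have identical preferences. That is, there exists an instance (sizes $n^\ell,n^r$, common degree constraints $d^\ell,d^r$ with $n^\ell d^\ell=n^r d^r$, $d^\ell\le n^r$, $d^r\le n^\ell$, and valuation functions) in which all left agents have the same valuation function, all right agents have the same valuation function, and no matching is $0.89$-DMMS.
   Context: Write $[n]=\{0,\ldots,n-1\}$. There are two disjoint groups of agents, $N^\ell=[n^\ell]$ (left) and $N^r=[n^r]$ (right). Every left agent has degree constraint $d^\ell\ge 1$ and every right agent has degree constraint $d^r\ge 1$. A (valid) matching is a binary $n^\ell\times n^r$ matrix $M$ in which every row sum is at most $d^\ell$ and every column sum is at most $d^r$; ''matching'' always means valid matching. Write $M^\ell_i=\{j\in N^r: M(i,j)=1\}$ and $M^r_j=\{i\in N^\ell: M(i,j)=1\}$. Each left agent $i$ has a valuation function $u^\ell_i:N^r\to\mathbb{R}_{\ge0}$ and each right agent $j$ a valuation function $u^r_j:N^\ell\to\mathbb{R}_{\ge0}$, extended additively to sets. Let $\mathcal{M}$ be the set of valid matchings. The maximin share values are $MMS^\ell_i=\max_{M\in\mathcal{M}}\min_{i'\in N^\ell}u^\ell_i(M^\ell_{i'})$ for $i\in N^\ell$ and $MMS^r_j=\max_{M\in\mathcal{M}}\min_{j'\in N^r}u^r_j(M^r_{j'})$ for $j\in N^r$. For $\alpha\in[0,1]$, a matching $M$ is $\alpha$-DMMS if $u^\ell_i(M^\ell_i)\ge\alpha\cdot MMS^\ell_i$ for every $i\in N^\ell$ and $u^r_j(M^r_j)\ge\alpha\cdot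 MMS^r_j$ for every $j\in N^r$. *)

(* Defs.v *)
From mathcomp Require Import all_boot all_order all_algebra.
From mathcomp Require Import reals.

Set Implicit Arguments.
Unset Strict Implicit.
Unset Printing Implicit Defensive.

Import Order.TTheory GRing.Theory Num.Theory.
Local Open Scope ring_scope.

(* A binary matrix is a boolean one; [M i j] coerces to 0 or 1 in the sums. *)
Definition valid_matching (nl nr dl dr : nat) (M : 'M[bool]_(nl, nr)) : bool :=
  [forall i, (\sum_(j < nr) M i j <= dl)%N] &&
  [forall j, (\sum_(i < nl) M i j <= dr)%N].

Definition left_bundle (nl nr : nat) (M : 'M[bool]_(nl, nr)) (i : 'I_nl) :
  {set 'I_nr} := [set j | M i j].

Definition right_bundle (nl nr : nat) (M : 'M[bool]_(nl, nr)) (j : 'I_nr) :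
  {set 'I_nl} := [set i | M i j].

Definition value (R : realType) (n : nat) (u : 'I_n -> R) (S : {set 'I_n}) : R :=
  \sum_(k in S) u k.

(* In the maximin shares below, the default values do not affect the result:
   the default of the minimum is the term indexed by the agent itself, and the
   default 0 of the maximum is the term indexed by the empty matching, which is
   always valid. *)
Definition left_MMS (R : realType) (nl nr dl dr : nat)
    (ul : 'I_nl -> 'I_nr -> R) (i : 'I_nl) : R :=
  \big[Num.max/0]_(M : 'M[bool]_(nl, nr) | valid_matching dl dr M)
    \big[Num.min/value (ul i) (left_bundle M i)]_(i' < nl)
      value (ul i) (left_bundle M i').

Definition right_MMS (R : realType) (nl nr dl dr : nat)
    (ur : 'I_nr -> 'I_nl -> R) (j : 'I_nr) : R :=
  \big[Num.max/0]_(M : 'M[bool]_(nl, nr) | valid_matching dl dr M)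
    \big[Num.min/value (ur j) (right_bundle M j)]_(j' < nr)
      value (ur j) (right_bundle M j').

Definition DMMS (R : realType) (nl nr dl dr : nat)
    (ul : 'I_nl -> 'I_nr -> R) (ur : 'I_nr -> 'I_nl -> R)
    (alpha : R) (M : 'M[bool]_(nl, nr)) : Prop :=
  (forall i, alpha * left_MMS dl dr ul i <= value (ul i) (left_bundle M i)) /\
  (forall j, alpha * right_MMS dl dr ur j <= value (ur j) (right_bundle M j)).

(* Main.v *)
Require Import Defs.
From mathcomp Require Import all_boot all_order all_algebra.
From mathcomp Require Import reals.
From mathcomp Require Import zify lra.

Import Order.TTheory GRing.Theory Num.Theory.

(** Take ten left agents of capacity 2, worth 3,3,1,1,1,1,0,0,0,0, and five
    right agents of capacity 4, worth 2,1,1,1,0.  The shares are 2 on the left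
    and 4 on the right (the latter by reading the left agents as the edges of
    K_5, each vertex receiving its incident edges); since all worths are
    integers, a 0.89-DMMS matching must give every agent its full share.
    Counting capacities, every left agent then gets exactly 2, i.e. either the
    right agent worth 2 and none of those worth 1, or exactly two of the three
    worth 1.  Counting worths, the four positive right agents get exactly 4
    each.  Let S be the bundle of the right agent worth 2: its complement has
    worth 6, and each right agent worth 1 misses worth exactly 2 of it.  Hence
    no left agent worth 3 lies outside S, as one of these three would miss it;
    but then S has worth at least 6, not 4. *)

Lemma eq_of_leq_sum (n : nat) (E F : 'I_n -> nat) :
  (forall i, (E i <= F i)) -> (\sum_i F i <= \sum_i E i) ->
  forall i, E i = F i.
Proof.
move=> leEF leFE i; apply/eqP; rewrite eqn_leq leEF /=.
move: leFE; rewrite (bigD1 i) //= [X in (_ <= X)](bigD1 i) //= => leFE.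
rewrite -(leq_add2r (\sum_(k | k != i) F k)); apply: leq_trans leFE _.
by rewrite leq_add2l; apply: leq_sum.
Qed.

Lemma forall_ord_iota (n : nat) (P : pred nat) :
  all P (iota 0 n) -> forall i : 'I_n, P i.
Proof. by move=> /allP Pn i; apply: Pn; rewrite mem_iota add0n ltn_ord. Qed.

(** For concrete [n] and [F] the right-hand side evaluates by conversion. *)
Lemma sum_ord_foldr (n : nat) (F : nat -> nat) :
  \sum_(i < n) F i = foldr addn 0 (map F (iota 0 n)).
Proof. by rewrite -(big_mkord xpredT) foldrE big_map /index_iota subn0. Qed.

Definition left_worth (i : nat) : nat := nth 0 [:: 3; 3; 1; 1; 1; 1] i.
Definition right_worth (j : nat) : nat := nth 0 [:: 2; 1; 1; 1] j.

Definition matching_of (s : seq (seq nat)) : 'M[bool]_(10, 5) :=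
  \matrix_(i, j) (val j \in nth [::] s i).

Definition left_optimum : seq (seq nat) :=
  [:: [:: 0; 4]; [:: 0; 4]; [:: 0; 4]; [:: 0; 4]; [:: 1; 2];
      [:: 1; 2]; [:: 1; 3]; [:: 1; 3]; [:: 2; 3]; [:: 2; 3]].

(** The edges of K_5: the two of worth 3 match the vertices 1 to 4 perfectly and the four of worth 1
    form the star at 0, so each vertex gets 3 + 1 or 1 + 1 + 1 + 1. *)
Definition right_optimum : seq (seq nat) :=
  [:: [:: 1; 4]; [:: 2; 3]; [:: 0; 1]; [:: 0; 2]; [:: 0; 3];
      [:: 0; 4]; [:: 1; 2]; [:: 1; 3]; [:: 2; 4]; [:: 3; 4]].

Lemma valid_matching_of (s : seq (seq nat)) :
  all (fun i => foldr addn 0 [seq (j \in nth [::] s i) : nat | j <- iota 0 5] <= 2)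
      (iota 0 10) ->
  all (fun j => foldr addn 0 [seq (j \in nth [::] s i) : nat | i <- iota 0 10] <= 4)
      (iota 0 5) ->
  valid_matching 2 4 (matching_of s).
Proof.
move=> rows cols; apply/andP; split; apply/forallP => k.
  under eq_bigr do rewrite mxE.
  by rewrite (sum_ord_foldr 5 (fun j => j \in nth [::] s k)); apply: (forall_ord_iota _ _ rows).
under eq_bigr do rewrite mxE.
by rewrite (sum_ord_foldr 10 (fun i => val k \in nth [::] s i)); apply: (forall_ord_iota _ _ cols).
Qed.

Lemma full_shares_infeasible (x : 'I_10 -> 'I_5 -> bool) :
  (forall j : 'I_5, \sum_(i < 10) x i j <= 4) ->
  (forall i : 'I_10, 2 <= \sum_(j < 5) right_worth j * x i j) ->
  (forall j : 'I_5, 4 <= \sum_(i < 10) left_worth i * x i j) -> False.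
Proof.
move=> cap lshare rshare.
(* Right worths sum to 5, so capacity 4 supplies at most 20, exactly ten shares of 2. *)
have row (i : 'I_10) : 2 = (\sum_(j < 5) right_worth j * x i j).
  move: i; apply: eq_of_leq_sum => //.
  rewrite exchange_big /=; under eq_bigr do rewrite -big_distrr /=.
  apply: (@leq_trans (\sum_(j < 5) right_worth j * 4)).
    by apply: leq_sum => j _; rewrite leq_mul2l cap orbT.
  by rewrite sum_nat_const card_ord (sum_ord_foldr 5 (fun j => right_worth j * 4)).
(* With the weights [right_worth j] both sides total 20: by [row], left agent [i] contributes
   [left_worth i * 2] on the right. *)
have col (j : 'I_5) : (right_worth j * 4 = right_worth j * \sum_(i < 10) left_worth i * x i j).
  move: j; apply: eq_of_leq_sum => [j|]; first by rewrite leq_mul2l rshare orbT.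
  under eq_bigr do rewrite big_distrr /=.
  rewrite exchange_big /=.
  under eq_bigr => i _ do
    (under eq_bigr do rewrite mulnCA; rewrite -big_distrr /= -row).
  by rewrite (sum_ord_foldr 10 (fun i => left_worth i * 2))
             (sum_ord_foldr 5 (fun j => right_worth j * 4)).
have col0 : 4 = \sum_(i < 10) left_worth i * x i ord0.
  by apply/eqP; rewrite -(eqn_pmul2l (isT : 0 < 2)) (col ord0).
have big_in_S (i : 'I_10) : left_worth i = 3 -> x i ord0.
  move=> wi; apply/negPn/negP => /negbTE xi0.
  (* Without the agent worth 2, [i] holds exactly two of the three worth 1; [j] is the third. *)
  have [j wj xij] : exists2 j : 'I_5, right_worth j = 1 & x i j = false.
    have := row i; rewrite !big_ord_recl big_ord0 /= xi0.
    case e1: (x i (lift _ _)); first case e2: (x i (lift _ _));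
      first case e3: (x i (lift _ _)); move=> //= _; by [exists (lift ord0 ord0)|
        exists (lift ord0 (lift ord0 ord0)) | exists (lift ord0 (lift ord0 (lift ord0 ord0)))].
  (* Holding both would give [k] at least 2 + 1 > 2. *)
  have disj (k : 'I_10) : x k j + x k ord0 <= 1.
    have j0 : j != ord0 by apply: contra_eq_neq wj => ->.
    have := row k; rewrite (bigD1 ord0) //= (bigD1 j) //= wj.
    by case: (x k j); case: (x k ord0); rewrite //= /right_worth /=; lia.
  (* Two disjoint bundles of worth 4 both miss [i], yet the other left agents are worth only 10 - 3
     = 7. *)
  have tot : \sum_(k < 10) left_worth k * (x k j + x k ord0) = 8.
    under eq_bigr do rewrite mulnDr.
    by rewrite big_split /= -col0; have := col j; rewrite wj !mul1n => <-.
  have : \sum_(k < 10 | k != i) left_worth k * (x k j + x k ord0) <=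
         \sum_(k < 10 | k != i) left_worth k.
    by apply: leq_sum => k _; rewrite -[leqRHS]muln1 leq_mul2l disj orbT.
  have : \sum_(k < 10) left_worth k = 10 by rewrite (sum_ord_foldr 10 left_worth).
  rewrite (bigD1 i) //= wi => /(@addnI 3 _ 7) ->.
  by move: tot; rewrite (bigD1 i) //= xij xi0 muln0 add0n => ->.
have := big_in_S (lift ord0 ord0) erefl; have := big_in_S ord0 erefl.
by move: col0; rewrite !big_ord_recl => /[swap] -> /[swap] ->.
Qed.

Local Open Scope ring_scope.

Lemma left_MMS_ge (R : realType) (nl nr dl dr : nat)
    (ul : 'I_nl -> 'I_nr -> R) (i : 'I_nl) (c : R) (M : 'M[bool]_(nl, nr)) :
  valid_matching dl dr M ->
  (forall i', c <= value (ul i) (left_bundle M i')) ->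
  c <= left_MMS dl dr ul i.
Proof.
move=> vM cM; apply: le_trans (le_bigmax_cond _ _ vM).
by apply: le_bigmin => // i' _; apply: cM.
Qed.

Lemma right_MMS_ge (R : realType) (nl nr dl dr : nat)
    (ur : 'I_nr -> 'I_nl -> R) (j : 'I_nr) (c : R) (M : 'M[bool]_(nl, nr)) :
  valid_matching dl dr M ->
  (forall j', c <= value (ur j) (right_bundle M j')) ->
  c <= right_MMS dl dr ur j.
Proof.
move=> vM cM; apply: le_trans (le_bigmax_cond _ _ vM).
by apply: le_bigmin => // j' _; apply: cM.
Qed.

Lemma value_natE (R : realType) (n : nat) (w : 'I_n -> nat) (S : {set 'I_n}) :
  value (fun k => (w k)%:R : R) S = (\sum_k w k * (k \in S))%N%:R.
Proof.
rewrite /value -natr_sum big_mkcond /=; congr _%:R.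
by apply: eq_bigr => k _; case: (k \in S); rewrite ?muln1 ?muln0.
Qed.

Lemma left_MMS_ge2 (R : realType) (i : 'I_10) :
  2%:R <= left_MMS 2 4 (fun _ (j : 'I_5) => (right_worth j)%:R : R) i.
Proof.
apply: (left_MMS_ge _ _ _ _ _ _ _ _ (matching_of left_optimum)).
  exact: valid_matching_of.
move=> i'; rewrite value_natE ler_nat; under eq_bigr do rewrite inE mxE.
pose F i j := (right_worth j * (j \in nth [::] left_optimum i))%N.
rewrite (sum_ord_foldr 5 (F i')).
exact: (forall_ord_iota 10 (fun i => 2 <= foldr addn 0 (map (F i) (iota 0 5)))%N).
Qed.

Lemma right_MMS_ge4 (R : realType) (j : 'I_5) :
  4%:R <= right_MMS 2 4 (fun _ (i : 'I_10) => (left_worth i)%:R : R) j.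
Proof.
apply: (right_MMS_ge _ _ _ _ _ _ _ _ (matching_of right_optimum)).
  exact: valid_matching_of.
move=> j'; rewrite value_natE ler_nat; under eq_bigr do rewrite inE mxE.
pose F j i := (left_worth i * (j \in nth [::] right_optimum i))%N.
rewrite (sum_ord_foldr 10 (F j')).
exact: (forall_ord_iota 5 (fun j => 4 <= foldr addn 0 (map (F j) (iota 0 10)))%N).
Qed.

(** If [v] were at most [T - 1], then 89 T <= 100 (T - 1), that is 100 <= 11 T, which fails for [T]
    up to 9. *)
Lemma natr_ge_of_ratio (R : realType) (T v : nat) (m : R) :
  (T <= 9)%N -> T%:R <= m -> 89%:R / 100%:R * m <= v%:R -> (T <= v)%N.
Proof.
move=> T9 Tm mv.
have : 89%:R * T%:R <= 100%:R * v%:R :> R by lra.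
rewrite -!natrM ler_nat; lia.
Qed.

Theorem theorem3 (R : realType) :
  exists (nl nr dl dr : nat) (ul : 'I_nl -> 'I_nr -> R) (ur : 'I_nr -> 'I_nl -> R),
    [/\ (1 <= dl)%N, (1 <= dr)%N, (nl * dl = nr * dr)%N,
        (dl <= nr)%N & (dr <= nl)%N] /\
    (forall i j, 0 <= ul i j) /\
    (forall j i, 0 <= ur j i) /\
    (forall i i' j, ul i j = ul i' j) /\
    (forall j j' i, ur j i = ur j' i) /\
    ~ (exists M : 'M[bool]_(nl, nr),
         valid_matching dl dr M /\ DMMS dl dr ul ur (89%:R / 100%:R) M).
Proof.
exists 10, 5, 2, 4, (fun _ j => (right_worth j)%:R), (fun _ i => (left_worth i)%:R).
do !split => //; try by move=> *; apply: ler0n.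
case=> M [/andP [_ /forallP cap] [lM rM]].
apply: (@full_shares_infeasible (fun i j => M i j)) => // [i|j].
  have := lM i; rewrite value_natE; under eq_bigr do rewrite inE.
  exact: natr_ge_of_ratio _ _ _ _ _ (left_MMS_ge2 R i).
have := rM j; rewrite value_natE; under eq_bigr do rewrite inE.
exact: natr_ge_of_ratio _ _ _ _ _ (right_MMS_ge4 R j).
Qed.
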